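(* Let $\mathbb X_i$, $i\in I$, be pairwise disjoint, connected and reversible $L_b$-structures and $\mathbb X=\bigcup_{i\in I}\mathbb X_i$. If every $\omega^*$-sequence in $I$ is trivial, then $\mathbb X$ is reversible.
   Context: An $L_b$-structure is a pair $\langle X,\rho\rangle$ with $\rho\subseteq X^2$. A homomorphism preserves the relation; a monomorphism is an injective homomorphism, a condensation a bijective homomorphism; $\mathrm{Mono}(\mathbb Y,\mathbb Z)$ and $\mathrm{Iso}(\mathbb Y,\mathbb Z)$ denote the sets of monomorphisms and isomorphisms. A structure is reversible iff every condensation from it to itself is an automorphism. Components are the classes of the smallest equivalence relation containing $\rho$; connected means exactly one component. The union of disjoint structures is $\langle\bigcup X_i,\bigcup\rho_i\rangle$. Write $\mathbb Y\preccurlyeq_m\mathbb Z$ iff there is a monomorphism $\mathbb Y\to\mathbb Z$. An $\omega^*$-sequence in $I$ is an injection $k\mapsto i_k$ from $\omega$ to $I$ such that $\mathbb X_{i_l}\preccurlyeq_m\mathbb X_{i_k}$ whenever $k<l$; it is trivial iff $\mathrm{Mono}(\mathbb X_{i_1},\mathbb X_{i_0})=\mathrm{Iso}(\mathbb X_{i_1},\mathbb X_{i_0})$. *)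

(* Defs.v *)
From mathcomp Require Import all_boot.
From mathcomp Require Import boolp classical_sets functions.

Set Implicit Arguments.
Unset Strict Implicit.
Unset Printing Implicit Defensive.

Local Open Scope classical_set_scope.

(* All structures live on subsets of an ambient type U, so that disjointness
   and union are those of sets. *)
Record Lb_structure (U : Type) := LbStructure {
  lb_dom : set U;
  lb_rel : set (U * U);
  lb_rel_dom : lb_rel `<=` lb_dom `*` lb_dom
}.

Section Morphisms.
Variable U : Type.
Implicit Types (X Y Z : Lb_structure U) (f : U -> U).

(* A map from Y to Z is given by a total function on U, of which only the
   restriction to lb_dom Y matters. *)
Definition homomorphism Y Z f :=
  set_fun (lb_dom Y) (lb_dom Z) f /\
  (forall x y, lb_rel Y (x, y) -> lb_rel Z (f x, f y)).

Definition Mono Y Z : set (U -> U) :=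
  [set f | homomorphism Y Z f /\ set_inj (lb_dom Y) f].

Definition Cond Y Z : set (U -> U) :=
  [set f | homomorphism Y Z f /\ set_bij (lb_dom Y) (lb_dom Z) f].

Definition Iso Y Z : set (U -> U) :=
  [set f | set_bij (lb_dom Y) (lb_dom Z) f /\
    (forall x y, lb_dom Y x -> lb_dom Y y ->
       (lb_rel Y (x, y) <-> lb_rel Z (f x, f y)))].

Definition Aut X := Iso X X.

Definition reversible X := Cond X X `<=` Aut X.

Definition mono_le Y Z := Mono Y Z !=set0.

Definition equivalence_on (D : set U) (E : set (U * U)) :=
  [/\ E `<=` D `*` D,
      (forall x, D x -> E (x, x)),
      (forall x y, E (x, y) -> E (y, x)) &
      (forall x y z, E (x, y) -> E (y, z) -> E (x, z))].

Definition conn_rel X : set (U * U) :=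
  smallest (equivalence_on (lb_dom X)) (lb_rel X).

Definition components X : set (set U) :=
  [set C | exists2 x, lb_dom X x & C = [set y | conn_rel X (x, y)]].

Definition connected X := exists C, components X = [set C].

End Morphisms.

Section Families.
Variables (U I : Type) (X : I -> Lb_structure U).

Definition pairwise_disjoint := trivIset [set: I] (fun i => lb_dom (X i)).

Lemma union_rel_dom :
  \bigcup_i lb_rel (X i) `<=` (\bigcup_i lb_dom (X i)) `*` (\bigcup_i lb_dom (X i)).
Proof. by move=> p [i _ /lb_rel_dom[p1 p2]]; split; exists i. Qed.

Definition Lb_union : Lb_structure U := LbStructure union_rel_dom.

Definition omega_star_seq (s : nat -> I) :=
  injective s /\ (forall k l, k < l -> mono_le (X (s l)) (X (s k))).

Definition trivial_seq (s : nat -> I) :=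
  Mono (X (s 1)) (X (s 0)) = Iso (X (s 1)) (X (s 0)).

End Families.

(* Main.v *)
Require Import Defs.
From mathcomp Require Import all_boot.
From mathcomp Require Import boolp classical_sets functions.

                                                                              
                                                                             
                                                                                
                                                                             
                                                                          
                                                                                 
                                                                      
                                                                             
                             

Set Implicit Arguments.
Unset Strict Implicit.
Unset Printing Implicit Defensive.

Local Open Scope classical_set_scope.

(** Let [f] be a condensation of the union. Since each [X i] is connected, [f] sends it into a
    single component [X (g i)] ([homomorphism_component]), injectively; since [f] is onto, so is
    [g]. The index [a] is treated according to whether it lies on a cycle of [g]. If it does not, a
    backward orbit of [g] through [a], preceded by [g a], is an $\omega^*$-sequence whose first
    monomorphism is [f], so triviality makes [f] an isomorphism on [X a] ([nonperiodic_Iso]). If it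
    does, [f] maps [X a] onto [X (g a)] ([periodic_Cond]); going once around the cycle gives a
    condensation of [X a], an automorphism by reversibility, so [f] reflects the relation on [X a]
    ([condensation_Iso]). Finally, [f] being onto on each component forces [g] to be injective, so
    these isomorphisms glue to an automorphism. *)

Section Composition.
Variable U : Type.
Implicit Types (W Y Z : Lb_structure U) (f g : U -> U).

Lemma homomorphism_comp W Y Z f g :
  homomorphism W Y f -> homomorphism Y Z g -> homomorphism W Z (g \o f).
Proof.
move=> [fD fR] [gD gR]; split=> [x /fD/gD//|x y /fR/gR//].
Qed.

Lemma Mono_id Y : Mono Y Y id.
Proof. by split; [split|move=> x y]. Qed.

Lemma Mono_comp W Y Z f g : Mono W Y f -> Mono Y Z g -> Mono W Z (g \o f).
Proof.
move=> [fH fI] [gH gI]; split; first exact: homomorphism_comp fH gH.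
move=> x y xW yW gfE; apply: fI => //; apply: gI => //.
  by rewrite inE; apply: fH.1; rewrite -in_setE.
by rewrite inE; apply: fH.1; rewrite -in_setE.
Qed.

Lemma Cond_id Y : Cond Y Y id.
Proof.
by split; [split|split=> [x|x y|y Yy]; last exists y].
Qed.

Lemma Cond_comp W Y Z f g : Cond W Y f -> Cond Y Z g -> Cond W Z (g \o f).
Proof.
move=> [fH fB] [gH gB]; split; first exact: homomorphism_comp fH gH.
exact: set_bij_comp fB gB.
Qed.

Lemma connected_nonempty Y : connected Y -> lb_dom Y !=set0.
Proof.
move=> [C CE]; have [x Yx _] : components Y C by rewrite CE.
by exists x.
Qed.

Lemma connected_conn_rel Y x y :
  connected Y -> lb_dom Y x -> lb_dom Y y -> conn_rel Y (x, y).
Proof.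
move=> [C CE] Yx Yy.
have Cz z : lb_dom Y z -> [set t | conn_rel Y (z, t)] = C.
  move=> Yz; suff : components Y [set t | conn_rel Y (z, t)] by rewrite CE.
  by exists z.
suff : [set t | conn_rel Y (x, t)] y by [].
rewrite (Cz x Yx) -(Cz y Yy) => E [[_ Erefl _ _] _].
exact: Erefl.
Qed.

End Composition.

Section Condensation.
Variables (U I : Type) (X : I -> Lb_structure U).
Hypothesis X_disj : pairwise_disjoint X.
Hypothesis X_conn : forall i, connected (X i).

Lemma component_unique i j x : lb_dom (X i) x -> lb_dom (X j) x -> i = j.
Proof. by move=> Xix Xjx; apply: X_disj => //; exists x. Qed.

Lemma homomorphism_component f i :
  homomorphism (Lb_union X) (Lb_union X) f ->
  exists j, homomorphism (X i) (X j) f.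
Proof.
move=> [fD fR]; have [x0 Xx0] := connected_nonempty (X_conn i).
have [j _ Xjfx0] : lb_dom (Lb_union X) (f x0) by apply: fD; exists i.
have fij : set_fun (lb_dom (X i)) (lb_dom (X j)) f.
  move=> x Xx; have /= := connected_conn_rel (X_conn i) Xx0 Xx.
  (* Points of [X i] whose images lie in the same component: an equivalence containing the relation
     of [X i], hence containing [conn_rel]. *)
  pose E := [set p : U * U | [/\ lb_dom (X i) p.1, lb_dom (X i) p.2 &
    forall k, lb_dom (X k) (f p.1) <-> lb_dom (X k) (f p.2)]].
  move=> /(_ E)[]; last by move=> _ _ /(_ j)[+ _]; apply.
  split.
    split=> [[y z] [? ? _]//|y Xy|y z [? ? yz]|y z t [? ? yz] [? ? zt]] /=.
    - by split.
    - by split=> // k; split=> /yz.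
    - by split=> // k; split=> [/yz/zt|/zt/yz].
  move=> [y z] Ryz; have [/= Xy Xz] := lb_rel_dom Ryz; split=> //= k.
  have [k' _ /lb_rel_dom[/= Xy' Xz']] : lb_rel (Lb_union X) (f y, f z).
    by apply: fR; exists i.
  by split=> Xk; [rewrite (component_unique Xk Xy')
                 |rewrite (component_unique Xk Xz')].
exists j; split=> // x y Rxy.
have [k _ Rk] : lb_rel (Lb_union X) (f x, f y) by apply: fR; exists i.
have [/= Xkfx _] := lb_rel_dom Rk; have [/= Xix _] := lb_rel_dom Rxy.
by rewrite (component_unique (fij _ Xix) Xkfx).
Qed.

Variables (f : U -> U) (g : I -> I).
Hypothesis f_cond : Cond (Lb_union X) (Lb_union X) f.
Hypothesis fg_hom : forall i, homomorphism (X i) (X (g i)) f.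

Lemma condensation_inj i j x y :
  lb_dom (X i) x -> lb_dom (X j) y -> f x = f y -> x = y.
Proof.
have [_ [_ f_inj _]] := f_cond.
by move=> Xx Xy fE; apply: f_inj => //; rewrite inE; [exists i|exists j].
Qed.

Lemma condensation_preimage j y :
  lb_dom (X j) y -> exists i x, [/\ g i = j, lb_dom (X i) x & f x = y].
Proof.
have [_ [_ _ f_surj]] := f_cond.
move=> Xy; have [x [i _ Xx] fxE] : (f @` lb_dom (Lb_union X)) y.
  by apply: f_surj; exists j.
exists i, x; split=> //; apply: component_unique Xy.
by rewrite -fxE; apply: (fg_hom i).1.
Qed.

Lemma condensation_component_surj j : exists i, g i = j.
Proof.
have [y Xy] := connected_nonempty (X_conn j).
by have [i [_ [? _ _]]] := condensation_preimage Xy; exists i.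
Qed.

Lemma condensation_Mono i : Mono (X i) (X (g i)) f.
Proof.
split; first exact: fg_hom.
by move=> x y; rewrite !inE; apply: condensation_inj.
Qed.

(** The nonempty image of [X b] lies in [X (g a)], already covered by [X a], and [f] is
    injective. *)
Lemma set_surj_preimage_unique a b :
  set_surj (lb_dom (X a)) (lb_dom (X (g a))) f -> g b = g a -> b = a.
Proof.
move=> f_surj gE; have [x Xx] := connected_nonempty (X_conn b).
have [|x' Xx' fE] := f_surj (f x); first by rewrite -gE; apply: (fg_hom b).1.
by apply: (component_unique Xx); rewrite -(condensation_inj Xx' Xx fE).
Qed.

Hypothesis X_triv :
  forall s : nat -> I, omega_star_seq X s -> trivial_seq X s.

Definition periodic a := exists n, iter n.+1 g a = a.

Lemma nonperiodic_Iso a : ~ periodic a -> Iso (X a) (X (g a)) f.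
Proof.
move=> aNper; have [h hK] := choice condensation_component_surj.
(* The sequence is [g a, a, h a, h (h a), ...]; it starts at [g a] so that the pair tested by
   triviality is [X a], [X (g a)]. A repetition, pushed forward by [g] until it reaches [a], would
   make [a] periodic. *)
pose s n := if n is n'.+1 then iter n' h a else g a.
have gs n : g (s n.+1) = s n by case: n => [//|n]; apply: hK.
have iter_gs n m : iter n g (s (n + m)) = s m.
  by elim: n => [//|n IHn]; rewrite iterSr addSn gs.
have s_neq k l : k < l -> s k <> s l.
  move=> kl sE; apply: aNper.
  case: k kl sE => [|k]; case: l => [//|l] kl sE.
    exists l; rewrite iterSr -[g a]/(s 0) sE.
    by have := iter_gs l 1; rewrite addn1 => ->.
  exists (l - k).-1; rewrite prednK ?subn_gt0//.
  have := iter_gs l 1; rewrite addn1 -sE -{1}(@subnK k l (ltnW kl)) iterD.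
  by have := iter_gs k 1; rewrite addn1 => ->.
have /X_triv s_triv : omega_star_seq X s.
  split=> [k l sE|k l].
    by case: (ltngtP k l) => // /s_neq []; rewrite sE.
  move=> kl; rewrite -(subnK (ltnW kl)); elim: (l - k) => [|d [e eM]].
    by exists id; apply: Mono_id.
  exists (e \o f); apply: Mono_comp eM; rewrite addSn -(gs (d + k)).
  exact: condensation_Mono.
have := condensation_Mono a; rewrite -[Mono _ _]/(Mono (X (s 1)) (X (s 0))).
by rewrite s_triv.
Qed.

Lemma periodic_iter n m a : iter n g a = a -> iter (m * n) g a = a.
Proof. by move=> gE; elim: m => [//|m IHm]; rewrite mulSn iterD IHm. Qed.

(** The product of the two periods is a positive common period, and the orbits agree after one
    step. *)
Lemma periodic_inj a b : periodic a -> periodic b -> g b = g a -> b = a.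
Proof.
move=> [n an] [m bm] gE.
rewrite -(periodic_iter n.+1 bm) -(periodic_iter m.+1 an) mulnC.
by rewrite mulnS addSn !iterSr gE.
Qed.

Lemma periodic_Cond a : periodic a -> Cond (X a) (X (g a)) f.
Proof.
move=> a_per; have [fH f_inj] := condensation_Mono a; split=> //.
split=> // [|y Xy]; first exact: fH.1.
have [b [x [gE Xx fE]]] := condensation_preimage Xy.
suff <- : b = a by exists x.
(* If [b] were not periodic, [f] would map [X b] onto [X (g b)], leaving no room for the image of
   [X a] unless [a] is [b]. *)
have [|/nonperiodic_Iso [[_ _ f_surj] _]] := pselect (periodic b).
  by move=> b_per; apply: periodic_inj.
by apply/esym/set_surj_preimage_unique.
Qed.

Lemma periodic_iter_Cond n a :
  periodic a -> Cond (X a) (X (iter n g a)) (iter n f).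
Proof.
move=> a_per; elim: n => [|n IHn]; first exact: Cond_id.
have : periodic (iter n g a).
  by case: a_per => m am; exists m; rewrite -iterD addnC iterD am.
by move=> /periodic_Cond; apply: Cond_comp.
Qed.

Hypothesis X_rev : forall i, reversible (X i).

Lemma condensation_Iso a : Iso (X a) (X (g a)) f.
Proof.
have [a_per|/nonperiodic_Iso//] := pselect (periodic a).
have [fH f_bij] := periodic_Cond a_per.
split=> // x y Xx Xy; split=> [|Rf]; first exact: fH.2.
(* The remaining [n] steps of the cycle carry the relation between [f x] and [f y] back into [X a],
   where the automorphism [iter n.+1 f] reflects it to [x] and [y]. *)
have [n an] := a_per; have := periodic_iter_Cond n.+1 a_per.
rewrite an => /X_rev[_ /(_ x y Xx Xy) ->]; rewrite !iterSr.
have ga_per : periodic (g a) by exists n; rewrite -iterSr iterS an.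
have [[_ fn_rel] _] := periodic_iter_Cond n ga_per.
by have := fn_rel _ _ Rf; rewrite -iterSr an.
Qed.

End Condensation.

Theorem theorem3p2 (U I : Type) (X : I -> Lb_structure U)
  (X_disj : pairwise_disjoint X)
  (X_conn : forall i, connected (X i))
  (X_rev : forall i, reversible (X i))
  (X_triv : forall s : nat -> I, omega_star_seq X s -> trivial_seq X s) :
  reversible (Lb_union X).
Proof.
move=> f f_cond; have [f_hom f_bij] := f_cond.
have [g fg_hom] :=
  choice (fun i => homomorphism_component X_disj X_conn i f_hom).
have f_iso := condensation_Iso X_disj X_conn f_cond fg_hom X_triv X_rev.
split=> // x y [a _ Xax] [b _ Xby]; split=> [|[j _ Rj]]; first exact: f_hom.2.
have [/= Xjfx Xjfy] := lb_rel_dom Rj.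
have gaj := component_unique X_disj ((fg_hom a).1 _ Xax) Xjfx.
have gbj := component_unique X_disj ((fg_hom b).1 _ Xby) Xjfy.
have [[_ _ f_surj] fR] := f_iso a.
(* Related images lie in one component, so [g a] and [g b] coincide. *)
have ba : b = a.
  apply: (set_surj_preimage_unique X_disj X_conn f_cond fg_hom f_surj).
  by rewrite gaj.
by exists a => //; apply/fR; rewrite ?gaj // -ba.
Qed.
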